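(* Let $\alpha_n$ ($n=0,1,2,\ldots$) be the Taylor coefficients at $\varepsilon=0$ defined by $${}_3F_2\!\left(\tfrac{\varepsilon+2}2,\tfrac{\varepsilon+2}2,\tfrac{\varepsilon+2}2;\,1,\tfrac{\varepsilon+3}2;\,\tfrac14\right)=\sum_{n=0}^\infty\alpha_n\varepsilon^n .$$ Then for $n=0,1,2,\ldots$ $$\alpha_n=(-1)^n\sum_{j=1}^\infty\frac2j\,\frac1{\binom{2j}{j}}\sum\prod_{k=1}^n\frac{A_{k,j}^{m_k}}{m_k!\,k^{m_k}},$$ where the inner sum is over all non-negative integers $m_1,\ldots,m_n$ such that $m_1+2m_2+\cdots+n\,m_n=n$.
   Context: For positive integers $k,j$, $A_{k,j}:=S_k(2j-1)-1-4\,\frac{S_k(j-1)}{2^k}=\sum_{m=2}^{2j-1}\frac{2(-1)^{m+1}-1}{m^k}$, where $S_k(j)=\sum_{m=1}^j\frac1{m^k}$ (empty sums are $0$). ${}_3F_2(a_1,a_2,a_3;b_1,b_2;z)=\sum_{n\ge0}\frac{(a_1)_n(a_2)_n(a_3)_n}{(b_1)_n(b_2)_n}\frac{z^n}{n!}$ with $(a)_n=a(a+1)\cdots(a+n-1)$. Convention: $0^0=1$; for $n=0$ the inner sum consists of the single empty product $1$. *)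

(* Defs.v *)
From mathcomp Require Export all_boot all_order all_algebra.
From mathcomp Require Export all_classical all_reals all_analysis.
From mathcomp Require Export complex.
Export Order.TTheory GRing.Theory Num.Theory numFieldNormedType.Exports.

Set Implicit Arguments.
Unset Strict Implicit.
Unset Printing Implicit Defensive.

Local Open Scope classical_set_scope.
Local Open Scope complex_scope.
Local Open Scope ring_scope.

Definition pochhammer (K : fieldType) (a : K) (n : nat) : K :=
  \prod_(0 <= i < n) (a + i%:R).

Definition hyp3F2_term (K : fieldType) (a1 a2 a3 b1 b2 z : K) (n : nat) : K :=
  (pochhammer a1 n * pochhammer a2 n * pochhammer a3 n)
    / (pochhammer b1 n * pochhammer b2 n) * (z ^+ n / n`!%:R).

(* "3F2(a1, a2, a3; b1, b2; z) converges, with value s".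
   The alias R[i]^o carries the topology induced by the norm of R[i]. *)
Definition is_hyp3F2 (R : realType) (a1 a2 a3 b1 b2 z s : R[i]) : Prop :=
  series (fun n => hyp3F2_term a1 a2 a3 b1 b2 z n : R[i]^o) @ \oo --> (s : R[i]^o).

(* alpha is the sequence of Taylor coefficients at eps = 0 of the 3F2: for all
   complex eps near 0 both series converge, to the same value. *)
Definition is_taylor_expansion (R : realType) (alpha : nat -> R[i]) : Prop :=
  \forall eps \near (0 : R[i]^o), exists2 s : R[i],
    is_hyp3F2 ((eps + 2) / 2) ((eps + 2) / 2) ((eps + 2) / 2)
              1 ((eps + 3) / 2) (1 / 4) s
    & series (fun n => alpha n * eps ^+ n : R[i]^o) @ \oo --> (s : R[i]^o).

Definition powsum (R : realType) (k j : nat) : R :=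
  \sum_(1 <= m < j.+1) 1 / m%:R ^+ k.

(* Meant for k, j >= 1, where the natural-number subtractions are exact. *)
Definition Acoef (R : realType) (k j : nat) : R :=
  powsum R k (2 * j - 1) - 1 - 4 * (powsum R k (j - 1) / 2 ^+ k).

(* m i stands for m_(i+1), i = 0, ..., n-1; the constraint
   m_1 + 2 m_2 + ... + n m_n = n forces every m_k <= n, so letting the m_k
   range over {0, ..., n} loses nothing. *)
Definition inner_sum (R : realType) (n j : nat) : R :=
  \sum_(m : {ffun 'I_n -> 'I_n.+1} | (\sum_(i < n) i.+1 * m i == n)%N)
    \prod_(i < n) (Acoef R i.+1 j ^+ m i / ((m i)`!%:R * i.+1%:R ^+ m i)).

(* Main.v *)
Require Import Defs.
From mathcomp Require Import ring lra zify.

(* Write j = J + 1.  As formal power series in t = -eps, the inner sums satisfy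
   sum_n inner_sum n j t^n = exp (sum_k A_(k,j) t^k / k)
     = prod_(k < j) (1 - t/(2k))^3 / (1 - t/(2k+1)),
   and 2/j / 'C(2j, j) times this product is the J-th term of the 3F2 series.
   Both sides of the exponential formula obey Newton's recurrence
   (n+1) h_(n+1) = sum_(i <= n) A_(i+1) h_(n-i).
   The product form gives |inner_sum n j| <= (5/2)^J 2^n, while the weights are
   at most (1/4)^J, so for |eps| <= 1/4 the double series is dominated by a
   product of geometric series and the two summations can be exchanged.
   Uniqueness of Taylor coefficients follows by letting eps tend to 0 along the
   positive reals. *)

Set Implicit Arguments.
Unset Strict Implicit.
Unset Printing Implicit Defensive.

Local Open Scope classical_set_scope.
Local Open Scope complex_scope.
Local Open Scope ring_scope.

Import ComplexField.Normc.

Local Notation Re := complex.Re.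
Local Notation Im := complex.Im.

(** * Newton's recurrence for the inner sums *)

(* Coefficients of (1 - x X) U, where U has coefficients u. *)
Definition mul_lin (K : comPzRingType) (x : K) (u : nat -> K) (n : nat) : K :=
  u n - x * (if n is m.+1 then u m else 0).

(* The index of A is shifted: A i stands for A_(i+1). *)
Definition newton_upto (K : comPzRingType) (N : nat) (A h : nat -> K) : Prop :=
  h 0%N = 1 /\
  forall n, (n < N)%N -> n.+1%:R * h n.+1 = \sum_(i < n.+1) A i * h (n - i)%N.

(** In characteristic zero [n.+1] can be cancelled, so the recurrence determines each value from the
    earlier ones. *)
Lemma newton_upto_unique (K : numFieldType) (N : nat) (A h g : nat -> K) :
  newton_upto N A h -> newton_upto N A g -> forall n, (n <= N)%N -> h n = g n.
Proof.
move=> [h0 hS] [g0 gS]; elim/ltn_ind => -[_ _|n IH leN]; first by rewrite h0 g0.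
apply: (mulfI (_ : n.+1%:R != 0)); first by rewrite pnatr_eq0.
rewrite hS// gS//; apply: eq_bigr => i _; rewrite IH//; first by rewrite ltnS leq_subr.
exact: leq_trans (leq_subr _ _) (ltnW leN).
Qed.

Lemma newton_upto_le (K : comPzRingType) (M N : nat) (A h : nat -> K) :
  (M <= N)%N -> newton_upto N A h -> newton_upto M A h.
Proof. by move=> leMN [h0 hS]; split=> // n ltn; apply: hS; apply: leq_trans leMN. Qed.

Lemma eq_newton_upto (K : comPzRingType) (N : nat) (A B h : nat -> K) :
  A =1 B -> newton_upto N A h -> newton_upto N B h.
Proof.
by move=> eAB [h0 hS]; split=> // n /hS ->; apply: eq_bigr => i _; rewrite eAB.
Qed.

(** Newton's recurrence says that [A] lists the coefficients of the logarithmic derivative H'/H.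
    Multiplying H by 1 - xX adds -x/(1 - xX), whose coefficients are -x^(i+1). *)
Lemma newton_mul_lin (K : comPzRingType) (N : nat) (A h : nat -> K) (x : K) :
  newton_upto N A h -> newton_upto N (fun i => A i - x ^+ i.+1) (mul_lin x h).
Proof.
move=> [h0 hS]; split=> [|n ltnN]; first by rewrite /mul_lin mulr0 subr0.
(* The geometric series x/(1 - xX) cancels the factor 1 - xX and leaves x H. *)
have tel m : \sum_(i < m.+1) x ^+ i.+1 * mul_lin x h (m - i) = x * h m.
  elim: m => [|m IH]; first by rewrite big_ord1 expr1 /mul_lin subnn mulr0 subr0.
  rewrite big_ord_recl/= subn0 expr1.
  have -> : \sum_(i < m.+1) x ^+ (lift ord0 i).+1 * mul_lin x h (m.+1 - lift ord0 i) =
            x * (x * h m).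
    by rewrite -IH mulr_sumr; apply: eq_bigr => i _; rewrite lift0 subSS exprS mulrA.
  by rewrite /mul_lin; ring.
under eq_bigr do rewrite mulrBl; rewrite sumrB tel.
case: n ltnN => [|n] ltnN.
  have := hS 0%N ltnN; rewrite !big_ord1 /mul_lin/= subn0 h0 => e.
  by rewrite mulr0 subr0 -e; ring.
(* The last index meets [mul_lin x h 0], which has no shifted term; hence the second sum is one term
   shorter. *)
have -> : \sum_(i < n.+2) A i * mul_lin x h (n.+1 - i) =
  \sum_(i < n.+2) A i * h (n.+1 - i)%N - x * \sum_(i < n.+1) A i * h (n - i)%N.
  rewrite !(big_ord_recr n.+1)/= subnn /mul_lin mulr0 subr0 addrAC; congr (_ + _).
  rewrite mulr_sumr -sumrB; apply: eq_bigr => i _.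
  by rewrite subSn ?leq_ord//; ring.
rewrite -!hS//; last exact: ltnW.
by rewrite /mul_lin -[n.+2%:R]natr1; ring.
Qed.

(** * Truncated exponentials *)

Definition exp_trunc (R : realType) (N : nat) (a : R) (k : nat) : {poly R} :=
  \sum_(m < N.+1) ((a ^+ m / m`!%:R) *: 'X^(k * m)).

(** A polynomial stand-in for the exponential of the sum of A_(i+1) X^(i+1)/(i+1), for which formal
    differentiation is available. The exponents run up to [N], like the multiplicities in
    [inner_sum] for [n = N]. *)
Definition exp_prod (R : realType) (A : nat -> R) (N : nat) : {poly R} :=
  \prod_(i < N) exp_trunc N (A i / i.+1%:R) i.+1.

(* The exponential satisfies its differential equation up to the last term,
   whose degree is at least N. *)
Lemma exp_trunc_deriv (R : realType) (N : nat) (a : R) (i : nat) :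
  ((exp_trunc N (a / i.+1%:R) i.+1)^`() =
   a *: 'X^i * exp_trunc N (a / i.+1%:R) i.+1
     - (a * (a / i.+1%:R) ^+ N / N`!%:R) *: 'X^(i + i.+1 * N))%R.
Proof.
have mulX (b c : R) m k : (b *: 'X^m) * (c *: 'X^k) = (b * c) *: 'X^(m + k) :> {poly R}.
  by rewrite -scalerAl -scalerAr scalerA exprD.
rewrite /exp_trunc [in RHS]big_ord_recr/= mulrDr mulX.
rewrite [X in _ = _ + X *: _ - _](_ : _ = a * (a / i.+1%:R) ^+ N / N`!%:R); last by rewrite mulrA.
rewrite addrK big_ord_recl muln0 !expr0 derivD derivZ derivC scaler0 add0r.
rewrite (big_morph _ (@derivD R) (derivC 0)) mulr_sumr; apply: eq_bigr => m _.
rewrite mulX derivZ derivXn lift0 (_ : (i.+1 * m.+1).-1 = (i + i.+1 * m)%N); last by rewrite mulnS.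
rewrite -scalerMnr scalerMnl -mulr_natr factS exprS !natrM; congr (_ *: _).
have h1 : i.+1%:R != 0 :> R by rewrite pnatr_eq0.
have h2 : m.+1%:R != 0 :> R by rewrite pnatr_eq0.
have h3 : (m`!)%:R != 0 :> R by rewrite pnatr_eq0 -lt0n fact_gt0.
move: h1 h2 h3; move: (i.+1%:R) (m.+1%:R) (m`!%:R) => u v w h1 h2 h3.
by field; apply/and3P.
Qed.

(** By the Leibniz rule, relations P' = G P modulo X^N multiply: the factors G add up and the error
    stays divisible by X^N. *)
Lemma exp_prod_deriv (R : realType) (A : nat -> R) (N : nat) :
  exists r : {poly R},
    (exp_prod A N)^`() = (\sum_(i < N) A i *: 'X^i) * exp_prod A N + 'X^N * r.
Proof.
pose K (P G : {poly R}) := exists r : {poly R}, P^`() = G * P + 'X^N * r.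
apply: (big_ind2 K) => [|P1 G1 P2 G2 [r1 e1] [r2 e2]|i _].
- by exists 0; rewrite derivC mul0r mulr0 addr0.
- by exists (r1 * P2 + P1 * r2); rewrite derivM e1 e2; ring.
(* The error has degree i + (i+1)N = N + (i + iN), from which X^N is split off. *)
- exists (- (A i * (A i / i.+1%:R) ^+ N / N`!%:R) *: 'X^(i + i * N)).
  rewrite exp_trunc_deriv scaleNr mulrN -scalerAr -exprD.
  by rewrite mulSn addnA (addnC i N) addnA.
Qed.

Lemma exp_trunc_coef0 (R : realType) (N : nat) (a : R) (k : nat) :
  (exp_trunc N a k.+1)`_0 = 1.
Proof.
rewrite /exp_trunc big_ord_recl coefD muln0 coefZ coefXn expr0 fact0 divr1 mulr1.
rewrite coef_sum big1 ?addr0// => i _.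
by rewrite lift0 coefZ coefXn mulnS addSn mulr0.
Qed.

(** Comparison of the coefficients of X^n in the differential equation; for n < N the error term is
    invisible. *)
Lemma newton_exp_prod (R : realType) (A : nat -> R) (N : nat) :
  newton_upto N A (fun n => (exp_prod A N)`_n).
Proof.
split=> [|n ltnN].
  rewrite /exp_prod; elim/big_ind: _ => [|P Q P0 Q0|i _]; first by rewrite coef1.
    by rewrite coefM big_ord1 P0 Q0 mulr1.
  exact: exp_trunc_coef0.
have [r e] := exp_prod_deriv A N.
have := congr1 (fun P : {poly R} => P`_n) e.
rewrite coef_deriv coefD coefXnM ltnN addr0 => eN; rewrite mulr_natl eN.
rewrite coefM; apply: eq_bigr => i _; congr (_ * _).
rewrite coef_sum (bigD1 (Ordinal (leq_ltn_trans (leq_ord i) ltnN)))//=.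
rewrite coefZ coefXn eqxx mulr1 big1 ?addr0// => k neki.
rewrite coefZ coefXn [_ == _ :> nat](_ : _ = false) ?mulr0//.
by apply: contraNF neki => /eqP ek; apply/eqP/val_inj.
Qed.

(** Expanding the product of sums gives one monomial per choice of multiplicities, and the
    constraint on them selects degree n. *)
Lemma inner_sum_coef (R : realType) (n j : nat) :
  inner_sum R n j = (exp_prod (fun i => Acoef R i.+1 j) n)`_n.
Proof.
rewrite /exp_prod /exp_trunc bigA_distr_bigA coef_sum /inner_sum big_mkcond.
apply: eq_bigr => m _.
have -> : \prod_(i < n) (((Acoef R i.+1 j / i.+1%:R) ^+ m i / (m i)`!%:R) *: 'X^(i.+1 * m i)) =
   (\prod_(i < n) ((Acoef R i.+1 j / i.+1%:R) ^+ m i / (m i)`!%:R)) *: 'X^(\sum_(i < n) i.+1 * m i) :> {poly R}.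
  by rewrite scaler_prod -expr_sum.
rewrite coefZ coefXn eq_sym; case: eqP => _; rewrite ?mulr0// mulr1.
by apply: eq_bigr => i _; rewrite expr_div_n invfM -!mulrA [_^-1 * _^-1]mulrC.
Qed.

Lemma newton_inner_sum (R : realType) (N j : nat) :
  newton_upto N (fun i => Acoef R i.+1 j) (inner_sum R ^~ j).
Proof.
set A := fun i => _.
(* The polynomial representing [inner_sum R n j] depends on [n]; by uniqueness any truncation order
   m >= n gives the same coefficient, so one polynomial serves a whole instance of the
   recurrence. *)
have hE m n : (n <= m)%N -> inner_sum R n j = (exp_prod A m)`_n.
  move=> lenm; rewrite inner_sum_coef.
  apply: (newton_upto_unique (newton_exp_prod A n)) => //.
  exact: newton_upto_le (newton_exp_prod A m).
split=> [|n _]; first by rewrite (hE 0%N) ?(newton_exp_prod A 0).1.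
rewrite (hE n.+1)// (newton_exp_prod A n.+1).2//.
by apply: eq_bigr => i _; rewrite (hE n.+1) ?(leq_trans (leq_subr _ _)).
Qed.

(** * Passing from j to j + 1 *)

Lemma powsumS (R : realType) (k j : nat) :
  powsum R k j.+1 = powsum R k j + 1 / j.+1%:R ^+ k.
Proof. by rewrite /powsum big_nat_recr. Qed.

(** The two new terms have m = 2(j+1) and m = 2(j+1) + 1, where 2(-1)^(m+1) - 1 equals -3 and 1.
    They produce the cube and the denominator of the product form. *)
Lemma AcoefS (R : realType) (k j : nat) :
  Acoef R k j.+2 = Acoef R k j.+1 - 3 * (2 * j.+1)%:R^-1 ^+ k + (2 * j.+1).+1%:R^-1 ^+ k.
Proof.
have e1 : (2 * j.+2 - 1 = (2 * j).+3)%N by lia.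
have e2 : (2 * j.+1 - 1 = (2 * j).+1)%N by lia.
rewrite /Acoef e1 e2 !subn1 /= !powsumS (_ : (2 * j).+2 = 2 * j.+1)%N; last by lia.
rewrite !exprVn natrM exprMn.
by rewrite !invfM; ring.
Qed.

Lemma inner_sum1 (R : realType) (n : nat) : inner_sum R n 1 = (n == 0%N)%:R.
Proof.
have A1 i : Acoef R i 1 = 0.
  by rewrite /Acoef !subn1 /= /powsum big_nat1 big_geq// expr1n divr1 mul0r mulr0 !subr0 subrr.
have hd : newton_upto n (fun i => Acoef R i.+1 1) (fun m => (m == 0%N)%:R).
  by split=> // m _; rewrite mulr0 big1// => i _; rewrite A1 mul0r.
exact: (newton_upto_unique (newton_inner_sum R n 1) hd).
Qed.

(** Both sides satisfy Newton's recurrence with the same [A], by [AcoefS]. The denominator is kept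
    as a factor on the left, which avoids inverting a power series. *)
Lemma inner_sumS (R : realType) (n j : nat) :
  let y : R := (2 * j.+1)%:R^-1 in
  mul_lin ((2 * j.+1).+1%:R^-1) (inner_sum R ^~ j.+2) n =
  mul_lin y (mul_lin y (mul_lin y (inner_sum R ^~ j.+1))) n.
Proof.
move=> y; set w := _^-1.
have hN := newton_inner_sum R n.
have hy := newton_mul_lin y (newton_mul_lin y (newton_mul_lin y (hN j.+1))).
apply: (newton_upto_unique (newton_mul_lin w (hN j.+2)) _ (leqnn n)).
by apply: eq_newton_upto hy => i; rewrite AcoefS -/y -/w; ring.
Qed.

(** * Geometric bounds *)

(** Against 2^n a shift of index gains 1/2, so the factor is 1 + x/2 <= 5/4. *)
Lemma mul_lin_bound (R : realType) (u : nat -> R) (x C : R) :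
  0 <= x <= 1 / 2 -> (forall n, `|u n| <= C * 2 ^+ n) ->
  forall n, `|mul_lin x u n| <= C * (5 / 4) * 2 ^+ n.
Proof.
move=> /andP[x0 x12] hu n; rewrite /mul_lin; apply: (le_trans (ler_normB _ _)).
have := hu n; case: n => [|n] hn.
  by rewrite mulr0 normr0 addr0 expr0 mulr1; move: hn; rewrite expr0 mulr1; have := normr_ge0 (u 0%N); lra.
rewrite normrM (ger0_norm x0); move: hn (hu n); rewrite exprS.
have := normr_ge0 (u n); move: `|u n.+1| `|u n| (2 ^+ n) => a b c; nra.
Qed.

(** The new constant D has to satisfy C + D x/2 <= D; as x/2 <= 1/6, D = 6C/5 works. *)
Lemma mul_lin_bound_inv (R : realType) (u : nat -> R) (x C : R) :
  0 <= x <= 1 / 3 -> (forall n, `|mul_lin x u n| <= C * 2 ^+ n) ->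
  forall n, `|u n| <= C * (6 / 5) * 2 ^+ n.
Proof.
move=> /andP[x0 x13] hu; elim=> [|n IH].
  have := hu 0%N; rewrite /mul_lin mulr0 subr0 expr0 !mulr1.
  by have := normr_ge0 (u 0%N); lra.
have -> : u n.+1 = mul_lin x u n.+1 + x * u n by rewrite /mul_lin subrK.
apply: (le_trans (ler_normD _ _)); rewrite normrM (ger0_norm x0).
move: (hu n.+1) IH; rewrite exprS; have := normr_ge0 (u n).
by move: `|mul_lin _ _ _| `|u n| (2 ^+ n) => a b c; nra.
Qed.

(* Passing from J to J + 1 multiplies the bound by at most
   (5/4)^3 * (6/5) = 75/32 <= 5/2. *)
Lemma inner_sum_bound (R : realType) (J n : nat) :
  `|inner_sum R n J.+1| <= (5 / 2) ^+ J * 2 ^+ n.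
Proof.
elim: J n => [|J IH] n.
  rewrite inner_sum1 expr0 mul1r ger0_norm//.
  by case: n => [|n]; rewrite /= ?expr0// exprn_ge0.
have y0 : 0 <= ((2 * J.+1)%:R^-1 : R) <= 1 / 2.
  rewrite invr_ge0 ler0n/= div1r lef_pV2 ?posrE ?ltr0n// ler_nat; lia.
have w0 : 0 <= ((2 * J.+1).+1%:R^-1 : R) <= 1 / 3.
  rewrite invr_ge0 ler0n/= div1r lef_pV2 ?posrE ?ltr0n// ler_nat; lia.
have hy := mul_lin_bound y0 (mul_lin_bound y0 (mul_lin_bound y0 IH)).
have hw m : `|mul_lin (2 * J.+1).+1%:R^-1 (inner_sum R ^~ J.+2) m| <=
    (5 / 2) ^+ J * (5 / 4) * (5 / 4) * (5 / 4) * 2 ^+ m.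
  by have := hy m; rewrite -[X in `|X|](inner_sumS R m J).
apply: (le_trans (mul_lin_bound_inv w0 hw n)).
rewrite ler_pM2r ?exprn_gt0// exprSr -!mulrA ler_pM2l ?exprn_gt0//; lra.
Qed.

(** * Binomial weights *)

Definition central_weight (R : realType) (J : nat) : R :=
  2 / J.+1%:R * (1 / 'C(2 * J.+1, J.+1)%:R).

Lemma central_weightS (R : realType) (J : nat) :
  central_weight R J.+1 = central_weight R J * (J.+1%:R / (2 * (2 * J.+1).+1%:R)).
Proof.
(* The ratio of consecutive central binomial coefficients: two absorption identities linked by the
   symmetry [h3]. *)
have eb : ('C(2 * J.+2, J.+2) * J.+2 = 2 * (2 * J.+1).+1 * 'C(2 * J.+1, J.+1))%N.
  have h1 := mul_bin_diag (2 * J.+2) J.+1.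
  have h2 := mul_bin_diag (2 * J.+1).+1 J.+1.
  have h3 : 'C((2 * J.+1).+1, J.+1) = 'C((2 * J.+1).+1, J.+2).
    by rewrite -[RHS]bin_sub; [congr 'C(_, _)|]; lia.
  move: h1; rewrite (_ : (2 * J.+2).-1 = (2 * J.+1).+1)%N; last by lia.
  rewrite h3 /= in h2 *; nia.
have c0 m : 'C(2 * m, m)%:R != 0 :> R by rewrite pnatr_eq0 -lt0n bin_gt0; lia.
transitivity (2 / ('C(2 * J.+2, J.+2) * J.+2)%:R : R).
  by rewrite /central_weight natrM; field; rewrite c0 -natrD pnatr_eq0.
rewrite eb /central_weight !natrM; field.
by rewrite c0 !(addrC 1) ?natr1 -?natrM ?natr1 !pnatr_eq0.
Qed.

Lemma central_weight0 (R : realType) : central_weight R 0 = 1.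
Proof. by rewrite /central_weight muln1 bin1; field. Qed.

(** * Convergence in the complex plane *)

Lemma normcB (R : realType) (x y : R[i]) : normc (x - y) = normc (y - x).
Proof. by apply: complexI; exact: (distrC x y). Qed.

Lemma normc_ge0 (R : realType) (x : R[i]) : 0 <= normc x.
Proof. by rewrite -lecR; exact: (normr_ge0 x). Qed.

Lemma normc_triangle (R : realType) (x y : R[i]) : normc (x + y) <= normc x + normc y.
Proof. by rewrite -lecR rmorphD; exact: (ler_normD x y). Qed.

Lemma normc_real (R : realType) (x : R) : normc x%:C = `|x|.
Proof. by rewrite /= expr0n addr0 sqrtr_sqr. Qed.

Lemma normcX (R : realType) (x : R[i]) (n : nat) : normc (x ^+ n) = normc x ^+ n.
Proof. by apply: complexI; rewrite rmorphXn; exact: (normrX n x). Qed.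

Lemma normc_sum (R : realType) (F : nat -> R[i]) (m n : nat) :
  normc (\sum_(m <= i < n) F i) <= \sum_(m <= i < n) normc (F i).
Proof.
elim/big_rec2: _ => [|i a b _ leba]; first by rewrite normc0.
by apply: (le_trans (normc_triangle _ _)); rewrite lerD2l.
Qed.

Lemma normc_Re_le (R : realType) (x : R[i]) : `|Re x| <= normc x.
Proof. by rewrite -lecR; exact: normc_ge_Re. Qed.

Lemma normc_Im_le (R : realType) (x : R[i]) : `|Im x| <= normc x.
Proof. by case: x => a b /=; rewrite -sqrtr_sqr ler_wsqrtr// lerDr sqr_ge0. Qed.

Lemma normc_le_ReIm (R : realType) (x : R[i]) : normc x <= `|Re x| + `|Im x|.
Proof.
rewrite [in leLHS](complexE x); apply: (le_trans (normc_triangle _ _)).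
by rewrite normcM !normc_real /= expr0n expr1n add0r sqrtr1 mul1r.
Qed.

(** The norm of [R[i]] takes values in [R[i]] itself, but a positive element there is real, so real
    and complex tolerances correspond. *)
Lemma cvgC_normcP (R : realType) (u : nat -> R[i]) (l : R[i]) :
  (u @ \oo --> (l : R[i]^o)) <-> ((fun n => normc (u n - l)) @ \oo --> (0 : R)).
Proof.
split=> [/(@cvgrPdist_lt _ R[i]^o) h|/cvgrPdist_lt h].
  apply/cvgrPdist_lt => e e0.
  have eC : 0 < e%:C :> R[i] by rewrite ltcR.
  apply: filterS (h _ eC) => n hn.
  by rewrite sub0r normrN ger0_norm ?normc_ge0// normcB -ltcR; exact: hn.
apply/(@cvgrPdist_lt _ R[i]^o) => e e0.
have eE : e = (Re e)%:C by rewrite RRe_real// gtr0_real.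
have e0' : 0 < Re e by rewrite -ltcR -eE.
apply: filterS (h _ e0') => n.
by rewrite sub0r normrN ger0_norm ?normc_ge0// normcB -ltcR -eE.
Qed.

Lemma cvgC_Re (R : realType) (u : nat -> R[i]) (l : R[i]) :
  u @ \oo --> (l : R[i]^o) -> (fun n => Re (u n)) @ \oo --> Re l.
Proof.
move=> /cvgC_normcP /cvgrPdist_lt h; apply/cvgrPdist_lt => e /h; apply: filterS => n.
rewrite sub0r normrN ger0_norm ?normc_ge0// normcB; apply: le_lt_trans.
by rewrite -raddfB; exact: normc_Re_le.
Qed.

Lemma cvgC_Im (R : realType) (u : nat -> R[i]) (l : R[i]) :
  u @ \oo --> (l : R[i]^o) -> (fun n => Im (u n)) @ \oo --> Im l.
Proof.
move=> /cvgC_normcP /cvgrPdist_lt h; apply/cvgrPdist_lt => e /h; apply: filterS => n.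
rewrite sub0r normrN ger0_norm ?normc_ge0// normcB; apply: le_lt_trans.
by rewrite -raddfB; exact: normc_Im_le.
Qed.

Lemma cvgC_ReIm (R : realType) (u : nat -> R[i]) (a b : R) :
  (fun n => Re (u n)) @ \oo --> a -> (fun n => Im (u n)) @ \oo --> b ->
  u @ \oo --> (a +i* b : R[i]^o).
Proof.
move=> ua ub; apply/cvgC_normcP.
have h : (fun n => `|Re (u n) - a| + `|Im (u n) - b|) @ \oo --> (0 : R).
  rewrite -[0](addr0 0) -{1}(normr0 R) -[X in `|X| + _](subrr a) -(normr0 R) -(subrr b).
  by apply: cvgD; apply: cvg_norm; apply: cvgB => //; exact: cvg_cst.
apply: (squeeze_cvgr _ (cvg_cst (0 : R)) h); apply: nearW => n.
by rewrite normc_ge0; apply: (le_trans (normc_le_ReIm _)); rewrite !raddfB.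
Qed.

Lemma cvg_series_geometric_bound (R : realType) (C q : R) (f : nat -> R) :
  0 <= q < 1 -> (forall n, `|f n| <= C * q ^+ n) -> cvgn (series f).
Proof.
move=> /andP[q0 q1] hf; apply: normed_cvg.
apply: (@series_le_cvg _ _ (geometric C q)) => //.
- by move=> n; exact: normr_ge0.
- by move=> n; exact: le_trans (normr_ge0 _) (hf n).
by apply: is_cvg_geometric_series; rewrite ger0_norm.
Qed.

(** The modulus dominates real and imaginary parts, so each of them converges in [R]. *)
Lemma cvgC_series_geometric_bound (R : realType) (C q : R) (z : nat -> R[i]) :
  0 <= q < 1 -> (forall n, normc (z n) <= C * q ^+ n) ->
  exists s : R[i], series z @ \oo --> (s : R[i]^o).
Proof.
move=> q01 hz.
have hR : cvgn (series (fun n => Re (z n))).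
  by apply: (cvg_series_geometric_bound q01) => n; exact: le_trans (normc_Re_le _) (hz n).
have hI : cvgn (series (fun n => Im (z n))).
  by apply: (cvg_series_geometric_bound q01) => n; exact: le_trans (normc_Im_le _) (hz n).
exists (limn (series (fun n => Re (z n))) +i* limn (series (fun n => Im (z n)))).
apply: cvgC_ReIm.
  have -> // : (fun n => Re (series z n)) = series (fun n => Re (z n)).
  by apply/funext => n; rewrite /series/= raddf_sum.
have -> // : (fun n => Im (series z n)) = series (fun n => Im (z n)).
by apply/funext => n; rewrite /series/= raddf_sum.
Qed.

Lemma sum_geometric_le (R : realType) (q : R) (m n : nat) : 0 <= q < 1 -> (m <= n)%N ->
  \sum_(m <= i < n) q ^+ i <= q ^+ m / (1 - q).
Proof.
move=> /andP[q0 q1] lemn; rewrite -(subnKC lemn) geometric_partial_tail.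
rewrite geometric_seriesE ?lt_eqF//=.
by rewrite ler_pM2r ?invr_gt0 ?subr_gt0// ler_piMr ?exprn_ge0// gerBl exprn_ge0.
Qed.

Lemma limn_series_tail_le (R : realType) (C q : R) (f : nat -> R) (K : nat) :
  0 <= q < 1 -> (forall n, `|f n| <= C * q ^+ n) ->
  `|limn (series f) - series f K| <= C * (q ^+ K / (1 - q)).
Proof.
move=> q01 hf; have cf := cvg_series_geometric_bound q01 hf.
have C0 : 0 <= C by have := hf 0%N; rewrite expr0 mulr1; exact: le_trans.
have h : (fun n => `|series f n - series f K|) @ \oo --> `|limn (series f) - series f K|.
  by apply: cvg_norm; apply: cvgB => //; exact: cvg_cst.
apply: (cvgr_to_le h); near=> n.
have leKn : (K <= n)%N by near: n; exact: nbhs_infty_ge.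
rewrite sub_series_geq//; apply: (le_trans (ler_norm_sum _ _ _)).
apply: (le_trans (ler_sum _ (fun i _ => hf i))).
by rewrite -mulr_sumr ler_wpM2l// sum_geometric_le.
Unshelve. all: by end_near.
Qed.

(** * Exchange of summations *)

(** On partial sums, multiplication by 1 - xt leaves one boundary term, caused by the shift. *)
Lemma series_mul_lin (K : numFieldType) (u : nat -> K) (x t : K) (n : nat) :
  series (fun k => mul_lin x u k * t ^+ k) n.+1 =
  (1 - x * t) * series (fun k => u k * t ^+ k) n.+1 + x * t * (u n * t ^+ n).
Proof.
elim: n => [|n IH].
  by rewrite /series/= !big_nat1 /mul_lin; ring.
by rewrite seriesSr IH (seriesSr _ n.+1) /mul_lin exprS; ring.
Qed.

Lemma cvg_series_mul_lin (K : numFieldType) (u : nat -> K) (x t U : K) :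
  (series (fun k => u k * t ^+ k) : nat -> K^o) @ \oo --> (U : K^o) ->
  (series (fun k => mul_lin x u k * t ^+ k) : nat -> K^o) @ \oo --> ((1 - x * t) * U : K^o).
Proof.
move=> hU; rewrite -cvg_shiftS.
have h0 : (fun k => u k * t ^+ k : K^o) @ \oo --> (0 : K^o).
  by apply: (@cvg_series_cvg_0 _ K^o); apply/cvg_ex; exists U.
under eq_fun do rewrite series_mul_lin.
rewrite (_ : (1 - x * t) * U = (1 - x * t) * U + x * t * 0); last by rewrite mulr0 addr0.
apply: (@cvgD _ K^o).
  by apply: (@cvgMl_tmp K); rewrite (cvg_shiftS (series _)).
exact: (@cvgMl_tmp K).
Qed.

(** [series_mul_lin] is solved for the series of [u]. Its convergence is not known beforehand, so
    the vanishing of the boundary term is a separate hypothesis. *)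
Lemma cvg_series_mul_lin_inv (K : numFieldType) (u : nat -> K) (x t V : K) :
  1 - x * t != 0 -> (fun k => u k * t ^+ k : K^o) @ \oo --> (0 : K^o) ->
  (series (fun k => mul_lin x u k * t ^+ k) : nat -> K^o) @ \oo --> (V : K^o) ->
  (series (fun k => u k * t ^+ k) : nat -> K^o) @ \oo --> (V / (1 - x * t) : K^o).
Proof.
move=> xt h0 hV; rewrite -cvg_shiftS.
have -> : (fun n => series (fun k => u k * t ^+ k) n.+1) = (fun n =>
   (1 - x * t)^-1 * (series (fun k => mul_lin x u k * t ^+ k) n.+1 - x * t * (u n * t ^+ n))).
  by apply/funext => n; rewrite series_mul_lin addrK mulKf.
rewrite (_ : V / (1 - x * t) = (1 - x * t)^-1 * (V - x * t * 0)); last first.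
  by rewrite mulr0 subr0 mulrC.
apply: (@cvgMl_tmp K); apply: (@cvgB _ K^o).
  by rewrite (cvg_shiftS (series _)).
exact: (@cvgMl_tmp K).
Qed.

Lemma cvgC0_geometric_bound (R : realType) (C q : R) (z : nat -> R[i]) :
  0 <= q < 1 -> (forall n, normc (z n) <= C * q ^+ n) ->
  z @ \oo --> (0 : R[i]^o).
Proof.
move=> q01 hz; have [s hs] := cvgC_series_geometric_bound q01 hz.
by apply: (@cvg_series_cvg_0 _ R[i]^o); apply/cvg_ex; exists s.
Qed.

Lemma cvgC_D (R : realType) (u v : nat -> R[i]) (a b : R[i]) :
  u @ \oo --> (a : R[i]^o) -> v @ \oo --> (b : R[i]^o) ->
  (fun n => u n + v n) @ \oo --> (a + b : R[i]^o).
Proof.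
move=> /cvgC_normcP ua /cvgC_normcP vb; apply/cvgC_normcP.
have h : (fun n => normc (u n - a) + normc (v n - b)) @ \oo --> (0 : R).
  by rewrite -[0](addr0 0); exact: cvgD ua vb.
apply: (squeeze_cvgr _ (cvg_cst (0 : R)) h); apply: nearW => n.
rewrite normc_ge0 (_ : _ - _ = (u n - a) + (v n - b)); last by ring.
exact: normc_triangle.
Qed.

(** Since 2 |t| <= 1/2, the double series is dominated by C r^J (1/2)^n. Cutting J at K costs at
    most a constant times r^K, uniformly in the cut-off N of n; N goes to infinity first, then K. *)
Lemma exchange_series (R : realType) (b : nat -> nat -> R) (C r : R) (t : R[i])
    (T : nat -> R[i]) :
  0 <= r < 1 -> normc t <= 1 / 4 ->
  (forall J n, `|b J n| <= C * r ^+ J * 2 ^+ n) ->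
  (forall J, series (fun n => (b J n)%:C * t ^+ n) @ \oo --> (T J : R[i]^o)) ->
  exists2 s : R[i], series T @ \oo --> (s : R[i]^o) &
    series (fun n => (limn (series (b ^~ n)))%:C * t ^+ n) @ \oo --> (s : R[i]^o).
Proof.
move=> r01 t4 hb hT; have /andP[r0 r1] := r01.
pose a n := limn (series (b ^~ n)).
have C0 : 0 <= C by have := hb 0%N 0%N; rewrite !expr0 !mulr1; exact: le_trans.
have D0 : 0 <= C / (1 - r) by rewrite divr_ge0// subr_ge0 ltW.
have tail n K : `|a n - series (b ^~ n) K| <= C / (1 - r) * r ^+ K * 2 ^+ n.
  have hn J : `|b J n| <= C * 2 ^+ n * r ^+ J by rewrite mulrAC.
  apply: (le_trans (limn_series_tail_le K r01 hn)); rewrite [leLHS](_ : _ = C / (1 - r) * r ^+ K * 2 ^+ n)//; ring.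
have t0 := normc_ge0 t.
have pw n : 2 ^+ n * normc t ^+ n <= (1 / 2) ^+ n.
  by rewrite -exprMn lerXn2r// ?nnegrE; [lra|lra|lra].
have half : 0 <= (1 / 2 : R) < 1 by apply/andP; split; lra.
have [s hs] : exists s, series (fun n => (a n)%:C * t ^+ n) @ \oo --> (s : R[i]^o).
  apply: (cvgC_series_geometric_bound (C := C / (1 - r)) half) => n.
  rewrite normcM normc_real normcX.
  (* The tail from K = 0 is all of [a n]. *)
  have := tail n 0%N; rewrite /series/= big_geq// subr0 expr0 mulr1 => h.
  apply: (le_trans (ler_wpM2r (exprn_ge0 _ t0) h)).
  by rewrite -[leLHS]mulrA; apply: ler_wpM2l.
exists s => //; apply/cvgC_normcP.
have hST K : (fun N => \sum_(0 <= J < K) series (fun n => (b J n)%:C * t ^+ n) N)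
     @ \oo --> (series T K : R[i]^o).
  elim: K => [|K IH].
    have -> : series T 0 = 0 by rewrite /series/= big_nil.
    under eq_fun do rewrite big_nil.
    exact: (@cvg_cst R[i]^o).
  rewrite seriesSr.
  under eq_fun => N do rewrite (big_nat_recr K)//.
  exact: cvgC_D IH (hT K).
(* For fixed K, the distance is compared with that of the rectangular sums [S N] and [A N]; the two
   other errors vanish as N grows. The factor 2 is the sum of the powers of 1/2. *)
have bnd K : normc (series T K - s) <= 2 * (C / (1 - r)) * r ^+ K.
  pose S N := \sum_(0 <= J < K) series (fun n => (b J n)%:C * t ^+ n) N.
  pose A := series (fun n => (a n)%:C * t ^+ n).
  have h1 : (fun N => normc (S N - series T K)) @ \oo --> (0 : R).
    by apply/cvgC_normcP; exact: hST.
  have h2 : (fun N => normc (A N - s)) @ \oo --> (0 : R) by apply/cvgC_normcP.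
  have AS N : normc (S N - A N) <= 2 * (C / (1 - r)) * r ^+ K.
    have -> : S N - A N =
        - \sum_(0 <= n < N) (a n - series (b ^~ n) K)%:C * t ^+ n.
      rewrite /S /A /series/= exchange_big_nat/= -sumrB -sumrN; apply: eq_bigr => n _.
      by rewrite -mulr_suml rmorphB rmorph_sum; ring.
    rewrite normcN; apply: (le_trans (normc_sum _ _ _)).
    have le2 : \sum_(0 <= n < N) (1 / 2 : R) ^+ n <= 2.
      by apply: (le_trans (sum_geometric_le half (leq0n N))); rewrite expr0 (_ : 1 / (1 - 1 / 2) = 2)//; field.
    apply: (@le_trans _ _ (\sum_(0 <= n < N) C / (1 - r) * r ^+ K * (1 / 2) ^+ n)).
      apply: ler_sum => n _; rewrite normcM normc_real normcX.
      apply: (le_trans (ler_wpM2r (exprn_ge0 _ t0) (tail n K))).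
      by rewrite -[leLHS]mulrA; apply: ler_wpM2l (pw n); rewrite mulr_ge0 ?exprn_ge0.
    rewrite -mulr_sumr -[leRHS]mulrA [leRHS]mulrC.
    by apply: ler_wpM2l le2; rewrite mulr_ge0 ?exprn_ge0.
  have h : (fun N => 2 * (C / (1 - r)) * r ^+ K + (normc (S N - series T K) + normc (A N - s)))
     @ \oo --> 2 * (C / (1 - r)) * r ^+ K + (0 + 0).
    by apply: cvgD; [exact: cvg_cst|exact: cvgD].
  rewrite addr0 addr0 in h.
  apply: (cvgr_to_ge h); apply: nearW => N.
  rewrite (_ : series T K - s = (S N - A N) + ((series T K - S N) + (A N - s))); last by ring.
  apply: (le_trans (normc_triangle _ _)); apply: lerD => //.
  by apply: (le_trans (normc_triangle _ _)); rewrite (normcB (S N)).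
have hg : geometric (2 * (C / (1 - r))) r @ \oo --> (0 : R).
  by apply: cvg_geometric; rewrite ger0_norm.
apply: (squeeze_cvgr _ (cvg_cst (0 : R)) hg); apply: nearW => n.
by rewrite normc_ge0 bnd.
Qed.

(** * Summation of the hypergeometric terms *)

Lemma mul_lin_complex (R : realType) (x : R) (u : nat -> R) (n : nat) :
  (mul_lin x u n)%:C = mul_lin x%:C (fun k => (u k)%:C) n.
Proof. by rewrite /mul_lin rmorphB rmorphM; case: n => [|n]; rewrite ?rmorph0. Qed.

Lemma cvgC_shiftS (R : realType) (u : nat -> R[i]) (l : R[i]) :
  (fun n => u n.+1) @ \oo --> (l : R[i]^o) -> u @ \oo --> (l : R[i]^o).
Proof.
move=> /cvgC_normcP h; apply/cvgC_normcP.
by rewrite -(cvg_shiftS (fun n => normc (u n - l))).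
Qed.

(** With t = -eps, the ratio of consecutive terms of the 3F2 series divided by the ratio of
    consecutive weights. *)
Definition hyp_ratio (R : realType) (t : R[i]) (J : nat) : R[i] :=
  (1 - ((2 * J.+1)%:R^-1)%:C * t) ^+ 3 / (1 - ((2 * J.+1).+1%:R^-1)%:C * t).

Lemma hyp_ratio_den_neq0 (R : realType) (t : R[i]) (J : nat) : normc t <= 1 / 4 ->
  1 - ((2 * J.+1).+1%:R^-1)%:C * t != 0.
Proof.
move=> t4; have t0 := normc_ge0 t; set w : R := _^-1.
have w0 : 0 <= w by rewrite invr_ge0.
have w1 : w <= 1 by rewrite invf_le1 ?ler1n.
apply/eqP => /subr0_eq /(congr1 (@normc R)); rewrite normc1 normcM normc_real ger0_norm//.
by nra.
Qed.

(** Induction on J through [inner_sumS]: three multiplications by a linear factor and one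
    division. *)
Lemma cvg_inner_sum_series (R : realType) (t : R[i]) (J : nat) : normc t <= 1 / 4 ->
  series (fun n => (inner_sum R n J.+1)%:C * t ^+ n) @ \oo -->
    (\prod_(0 <= k < J) hyp_ratio t k : R[i]^o).
Proof.
move=> t4; have t0 := normc_ge0 t; elim: J => [|J IH].
  (* The partial sums are constantly 1 only from index 1 on, the one at index 0 being empty. *)
  rewrite big_nil; apply: cvgC_shiftS.
  have -> : (fun n => series (fun k => (inner_sum R k 1)%:C * t ^+ k) n.+1) = fun=> 1.
    apply/funext => n; elim: n => [|n IH].
      by rewrite /series/= big_nat1 inner_sum1 expr0 mulr1.
    by rewrite seriesSr IH inner_sum1 mul0r addr0.
  exact: (@cvg_cst R[i]^o).
rewrite (big_nat_recr _ _ _ (leq0n J)) /= /hyp_ratio mulrA.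
set y : R := (2 * J.+1)%:R^-1; set w : R := (2 * J.+1).+1%:R^-1.
apply: cvg_series_mul_lin_inv.
- exact: hyp_ratio_den_neq0.
- apply: (@cvgC0_geometric_bound _ ((5 / 2) ^+ J.+1) (1 / 2)); first by apply/andP; split; lra.
  move=> n; rewrite normcM normc_real normcX.
  apply: (le_trans (ler_wpM2r (exprn_ge0 _ t0) (inner_sum_bound R J.+1 n))).
  rewrite -mulrA -exprMn; apply: ler_wpM2l; first by rewrite exprn_ge0.
  by rewrite lerXn2r ?nnegrE; lra.
have -> : (fun n => mul_lin w%:C (fun k => (inner_sum R k J.+2)%:C) n * t ^+ n) =
   (fun n => mul_lin y%:C (mul_lin y%:C (mul_lin y%:C
      (fun k => (inner_sum R k J.+1)%:C))) n * t ^+ n).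
  apply/funext => n; rewrite -mul_lin_complex inner_sumS -/y mul_lin_complex; congr (_ * _).
  rewrite (_ : (fun k => _) = mul_lin y%:C (mul_lin y%:C (fun k => (inner_sum R k J.+1)%:C)))//.
  apply/funext => k; rewrite mul_lin_complex; congr mul_lin.
  by apply/funext => m; rewrite mul_lin_complex.
have h3 := cvg_series_mul_lin (x := y%:C) (cvg_series_mul_lin (x := y%:C)
  (cvg_series_mul_lin (x := y%:C) IH)).
set P := \prod_(_ <= _ < _) _ in h3 *.
rewrite (_ : P * _ = (1 - y%:C * t) * ((1 - y%:C * t) * ((1 - y%:C * t) * P))); last by ring.
exact: h3.
Qed.

(** (eps+2)/2 + J = (J+1)(1 + eps/(2J+2)) and (eps+3)/2 + J = (2J+3)/2 (1 + eps/(2J+3)); the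
    constants collect to the ratio in [central_weightS]. *)
Lemma hyp_term_ratio (R : realType) (eps : R[i]) (J : nat) : normc eps <= 1 / 4 ->
  ((eps + 2) / 2 + J%:R) ^+ 3 / ((1 + J%:R) * ((eps + 3) / 2 + J%:R)) * (1 / 4 / J.+1%:R) =
  (J.+1%:R / (2 * (2 * J.+1).+1%:R))%:C * hyp_ratio (- eps) J.
Proof.
move=> e4.
have := @hyp_ratio_den_neq0 _ (- eps) J; rewrite normcN => /(_ e4).
rewrite /hyp_ratio !(rmorphM, fmorphV, rmorph_nat) /=.
have J0 : 1 + J%:R != 0 :> R[i] by rewrite nat1r pnatr_eq0.
have J1 : 3 + 2 * J%:R != 0 :> R[i] by rewrite -natrM -natrD pnatr_eq0.
rewrite (_ : (2 * J.+1).+1%:R = 3 + 2 * J%:R); last by rewrite -natrM -natrD; congr _%:R; lia.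
rewrite natrM (_ : J.+1%:R = 1 + J%:R) => [h|]; last by rewrite nat1r.
have h2 : eps + 3 + 2 * J%:R != 0.
  apply: contraNneq h => h2.
  have -> : 1 - (3 + 2 * J%:R)^-1 * - eps = (3 + 2 * J%:R)^-1 * (eps + 3 + 2 * J%:R) by field.
  by rewrite h2 mulr0.
have h3 : 3 + 2 * J%:R - - eps != 0 by rewrite opprK addrC addrA.
by field; rewrite J0 J1 h3.
Qed.

Lemma hyp3F2_term_prod (R : realType) (eps : R[i]) (J : nat) : normc eps <= 1 / 4 ->
  hyp3F2_term ((eps + 2) / 2) ((eps + 2) / 2) ((eps + 2) / 2) 1 ((eps + 3) / 2) (1 / 4) J =
  (central_weight R J)%:C * \prod_(0 <= k < J) hyp_ratio (- eps) k.
Proof.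
move=> e4; elim: J => [|J IH].
  by rewrite /hyp3F2_term /pochhammer !big_geq// central_weight0 expr0 fact0 rmorph1; field.
have -> : forall a b z : R[i], hyp3F2_term a a a 1 b z J.+1 = hyp3F2_term a a a 1 b z J *
    ((a + J%:R) ^+ 3 / ((1 + J%:R) * (b + J%:R)) * (z / J.+1%:R)).
  move=> a b z; rewrite /hyp3F2_term /pochhammer !big_nat_recr//= factS natrM exprS.
  by rewrite !invfM; ring.
rewrite IH hyp_term_ratio// central_weightS big_nat_recr//=.
by rewrite (rmorphM (real_complex R) (central_weight R J)); ring.
Qed.

Lemma central_weight_bound (R : realType) (J : nat) : 0 <= central_weight R J <= (1 / 4) ^+ J.
Proof.
elim: J => [|J /andP[c0 c4]]; first by rewrite central_weight0 expr0 ler01 lexx.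
have q0 : 0 <= J.+1%:R / (2 * (2 * J.+1).+1%:R) :> R by rewrite divr_ge0// mulr_ge0.
have q4 : J.+1%:R / (2 * (2 * J.+1).+1%:R) <= 1 / 4 :> R.
  rewrite ler_pdivrMr ?mulr_gt0// -[(2 * J.+1).+1%:R]natr1 natrM.
  by have := ler0n R J.+1; nra.
by rewrite central_weightS mulr_ge0// exprSr ler_pM.
Qed.

(** * Vanishing of real power series *)

Lemma pseries_eq0_head (R : realType) (d : nat -> R) (e : R) : 0 < e ->
  (forall x : R, 0 < x < e -> pseries d x @ \oo --> (0 : R)) -> d 0%N = 0.
Proof.
move=> e0 hd; apply/eqP; case: eqVneq => // d0; exfalso.
have D0 : 0 < `|d 0%N| by rewrite normr_gt0.
pose r := e / 2; have r0 : 0 < r by rewrite divr_gt0.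
have re : 0 < r < e by rewrite r0 /r; lra.
have cr : cvgn (pseries d r) by apply/cvg_ex; exists 0; exact: hd.
(* Convergence at r bounds the terms, so at the point qr the i-th term is at most M q^i. *)
have [M hM] : exists M, forall n, `|d n| * r ^+ n <= M.
  have [K [_ /(_ (`|K| + 1)) hK]] := cvg_series_bounded cr.
  exists (`|K| + 1) => n.
  have lK : K < `|K| + 1 by rewrite (le_lt_trans (ler_norm K)) ?ltrDl.
  have : `|d n * r ^+ n| <= `|K| + 1 := hK lK n I.
  by rewrite normrM normrX (ger0_norm (ltW r0)).
have DM : `|d 0%N| <= M by have := hM 0%N; rewrite expr0 mulr1.
have M0 : 0 < M by exact: lt_le_trans DM.
(* With this q the terms after the first sum to at most M q/(1-q) <= 2Mq = |d 0|/2, too little to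
   cancel [d 0]. *)
pose q := `|d 0%N| / (4 * M).
have q0 : 0 < q by rewrite divr_gt0 ?mulr_gt0.
have q4 : q <= 1 / 4 by rewrite ler_pdivrMr ?mulr_gt0//; lra.
have qr : 0 < q * r < e by rewrite mulr_gt0//=; case/andP: re => _; nra.
have h : (fun N => `|pseries d (q * r) N.+1| + M * (2 * q)) @ \oo --> 0 + M * (2 * q).
  apply: cvgD; last exact: cvg_cst.
  have := cvg_norm (hd _ qr); rewrite normr0 => h0.
  rewrite (cvg_shiftS (fun n => `|pseries d (q * r) n|)). exact: h0.
rewrite add0r in h.
have : `|d 0%N| <= M * (2 * q).
  apply: (cvgr_to_ge h); apply: nearW => N.
  have eS : pseries d (q * r) N.+1 = d 0%N + \sum_(1 <= i < N.+1) d i * (q * r) ^+ i.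
    by rewrite /pseries/series/= big_ltn// expr0 mulr1.
  rewrite (_ : d 0%N = pseries d (q * r) N.+1 - \sum_(1 <= i < N.+1) d i * (q * r) ^+ i);
    last by rewrite eS addrK.
  apply: (le_trans (ler_normB _ _)); apply: lerD => //.
  apply: (le_trans (ler_norm_sum _ _ _)).
  apply: (@le_trans _ _ (\sum_(1 <= i < N.+1) M * q ^+ i)).
    apply: ler_sum => i _; rewrite normrM normrX (ger0_norm (ltW (mulr_gt0 q0 r0))).
    rewrite (_ : _ * _ = `|d i| * r ^+ i * q ^+ i); last by rewrite exprMn; ring.
    by apply: ler_wpM2r (hM i); rewrite exprn_ge0// ltW.
  rewrite -mulr_sumr; apply: ler_wpM2l; first exact: ltW.
  have q01 : 0 <= q < 1 by apply/andP; split; lra.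
  apply: (le_trans (sum_geometric_le q01 _)) => //.
  rewrite expr1 ler_pdivrMr; nra.
rewrite /q (_ : M * _ = `|d 0%N| / 2); last by field; rewrite gt_eqF.
lra.
Qed.

(** Once [d 0] vanishes, dividing by x > 0 leaves the shifted series with the same property. *)
Lemma pseries_eq0 (R : realType) (d : nat -> R) (e : R) : 0 < e ->
  (forall x : R, 0 < x < e -> pseries d x @ \oo --> (0 : R)) -> forall n, d n = 0.
Proof.
move=> e0 hd n; elim: n d hd => [|n IH] d hd; first exact: pseries_eq0_head hd.
apply: (IH (fun n => d n.+1)) => x xe; have d0 := pseries_eq0_head e0 hd.
have x0 : x != 0 by case/andP: xe => x0 _; rewrite gt_eqF.
have -> : pseries (fun n => d n.+1) x = (fun n => x^-1 * pseries d x n.+1).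
  apply/funext => m; rewrite /pseries/series/= big_nat_recl//= d0 mul0r add0r mulr_sumr.
  by apply: eq_bigr => i _; rewrite exprS mulrCA mulKf.
rewrite -(mulr0 x^-1); apply: cvgMl_tmp.
by rewrite (cvg_shiftS (pseries d x)); exact: hd.
Qed.

(** * Taylor coefficients *)

Lemma nearC0P (R : realType) (P : R[i] -> Prop) :
  (\forall z \near (0 : R[i]^o), P z) <->
  exists2 e : R, 0 < e & forall z, normc z < e -> P z.
Proof.
split=> [/nbhs_ballP[e /= e0 eP]|[e e0 eP]].
  have eE : e = (Re e)%:C by rewrite RRe_real// gtr0_real.
  exists (Re e) => [|z ze]; first by rewrite -ltcR -eE.
  apply: eP; rewrite -ball_normE /ball_ /=.
  have : (normc z)%:C < e by rewrite eE ltcR.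
  by rewrite sub0r normrN.
apply/nbhs_ballP; exists e%:C => [|z /=]; first by rewrite /= ltcR.
rewrite -ball_normE /ball_ /= sub0r normrN => ze.
by apply: eP; rewrite -ltcR; exact: ze.
Qed.

Lemma cvgC_Ml (R : realType) (c : R[i]) (u : nat -> R[i]) (l : R[i]) :
  u @ \oo --> (l : R[i]^o) -> (fun n => c * u n) @ \oo --> (c * l : R[i]^o).
Proof.
move=> /cvgC_normcP h; apply/cvgC_normcP.
have -> : (fun n => normc (c * u n - c * l)) = (fun n => normc c * normc (u n - l)).
  by apply/funext => n; rewrite -mulrBr normcM.
by rewrite -(mulr0 (normc c)); exact: (@cvgMl_tmp R).
Qed.

Lemma cvgC_unique (R : realType) (u : nat -> R[i]) (a b : R[i]) :
  u @ \oo --> (a : R[i]^o) -> u @ \oo --> (b : R[i]^o) -> a = b.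
Proof.
move=> ha hb; apply/eqP; rewrite eq_complex; apply/andP; split; apply/eqP.
  exact: (cvg_unique _ (cvgC_Re ha) (cvgC_Re hb)).
exact: (cvg_unique _ (cvgC_Im ha) (cvgC_Im hb)).
Qed.

(** At small real x > 0 both expansions have the value of the 3F2, so their difference sums to 0;
    its real and imaginary parts are real power series in x. *)
Lemma taylor_expansion_unique (R : realType) (alpha beta : nat -> R[i]) :
  is_taylor_expansion alpha -> is_taylor_expansion beta -> alpha =1 beta.
Proof.
move=> /nearC0P[e e0 ha] /nearC0P[f f0 hb] n.
pose g := Num.min e f.
have g0 : 0 < g by rewrite lt_min e0.
have hd x : 0 < x < g ->
    series (fun n => (alpha n - beta n) * x%:C ^+ n) @ \oo --> (0 : R[i]^o).
  rewrite lt_min => /and3P[x0 xe xf].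
  have nx : normc x%:C = x by rewrite normc_real gtr0_norm.
  have [s hs1 hs2] := ha x%:C (etrans (congr1 (<%R^~ e) nx) xe).
  have [s' hs1' hs2'] := hb x%:C (etrans (congr1 (<%R^~ f) nx) xf).
  have ss : s = s' := cvgC_unique hs1 hs1'.
  have := cvgC_D hs2 (cvgC_Ml (c := -1) hs2').
  rewrite ss (_ : s' + -1 * s' = 0); last by ring.
  apply: cvg_trans; apply: near_eq_cvg; apply: nearW => N.
  rewrite /series/= mulN1r -sumrB; apply: eq_bigr => i _; ring.
apply/eqP; rewrite eq_complex; apply/andP; split; rewrite -subr_eq0 -raddfB; apply/eqP.
  apply: (@pseries_eq0 _ (fun k => Re (alpha k - beta k)) g g0) => x xg.
  have := cvgC_Re (hd x xg); apply: cvg_trans; apply: near_eq_cvg; apply: nearW => N.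
  rewrite /pseries/series/= raddf_sum; apply: eq_bigr => i _.
  by rewrite -rmorphXn; case: (alpha i - beta i) => a b /=; rewrite mulr0 subr0.
apply: (@pseries_eq0 _ (fun k => Im (alpha k - beta k)) g g0) => x xg.
have := cvgC_Im (hd x xg); apply: cvg_trans; apply: near_eq_cvg; apply: nearW => N.
rewrite /pseries/series/= raddf_sum; apply: eq_bigr => i _.
by rewrite -rmorphXn; case: (alpha i - beta i) => a b /=; rewrite mulr0 add0r.
Qed.

Lemma central_weight_inner_sum_bound (R : realType) (J n : nat) :
  `|central_weight R J * inner_sum R n J.+1| <= 1 * (5 / 8) ^+ J * 2 ^+ n.
Proof.
have /andP[c0 c4] := central_weight_bound R J.
rewrite normrM (ger0_norm c0) (_ : 1 * _ * _ = (1 / 4) ^+ J * ((5 / 2) ^+ J * 2 ^+ n)).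
  by apply: ler_pM => //; exact: inner_sum_bound.
by rewrite mul1r mulrA -exprMn; congr (_ ^+ _ * _); field.
Qed.

(** The exchange is applied at t = -eps: the sums over n are the hypergeometric terms, those over J
    the coefficients. Here r = 1/4 * 5/2 = 5/8, and (-eps)^n supplies the sign. *)
Lemma hyp3F2_taylor (R : realType) :
  is_taylor_expansion (fun n =>
    ((-1) ^+ n * limn (series (fun J => central_weight R J * inner_sum R n J.+1)))%:C).
Proof.
apply/nearC0P; exists (1 / 4) => [|eps /ltW e4]; first by lra.
have t4 : normc (- eps) <= 1 / 4 by rewrite normcN.
have r01 : 0 <= (5 / 8 : R) < 1 by apply/andP; split; lra.
have hT J : series (fun n => (central_weight R J * inner_sum R n J.+1)%:C * (- eps) ^+ n) @ \oo -->
   (hyp3F2_term ((eps + 2) / 2) ((eps + 2) / 2) ((eps + 2) / 2) 1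
     ((eps + 3) / 2) (1 / 4) J : R[i]^o).
  rewrite hyp3F2_term_prod//.
  have := cvgC_Ml (c := (central_weight R J)%:C) (@cvg_inner_sum_series R _ J t4).
  apply: cvg_trans; apply: near_eq_cvg; apply: nearW => N.
  rewrite /series/= mulr_sumr; apply: eq_bigr => i _.
  by rewrite (rmorphM (real_complex R) (central_weight R J)) mulrA.
have [s hs1 hs2] := exchange_series r01 t4 (@central_weight_inner_sum_bound R) hT.
exists s; first exact: hs1.
move: hs2; apply: cvg_trans; apply: near_eq_cvg; apply: nearW => N.
rewrite /series/=; apply: eq_bigr => i _.
rewrite (rmorphM (real_complex R) ((-1) ^+ i)) rmorphXn rmorphN rmorph1 exprNn.
by rewrite mulrA [_ * (-1) ^+ i]mulrC.
Qed.

Theorem theorem4 (R : realType) :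
  (exists alpha : nat -> R[i], is_taylor_expansion alpha) /\
  (forall alpha : nat -> R[i], is_taylor_expansion alpha -> forall n : nat,
     let partial (N : nat) : R :=
       \sum_(1 <= j < N.+1) 2 / j%:R * (1 / 'C(2 * j, j)%:R) * inner_sum R n j in
     cvgn partial /\ alpha n = ((-1) ^+ n * limn partial)%:C).
Proof.
split; first by eexists; exact: hyp3F2_taylor.
move=> alpha ha n partial.
have -> : partial = series (fun J => central_weight R J * inner_sum R n J.+1).
  by apply/funext => N; rewrite /partial /series/= big_add1.
split; last exact: (taylor_expansion_unique ha (hyp3F2_taylor R)).
(* As n is fixed, the factor 2^n of the double bound is a constant. *)
apply: (@cvg_series_geometric_bound _ (2 ^+ n) (5 / 8)); first by apply/andP; split; lra.
by move=> J; rewrite (le_trans (central_weight_inner_sum_bound R J n))// mul1r mulrC.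
Qed.
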